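(* Every anti-involution $\sigma$ of the associative superalgebra $\mathcal{SD}_{as}$ which preserves the principal gradation is one of the following, where $a\in\mathbb C$ and $b\in\mathbb C^{\times}$: 1) $\sigma_{a,b}(t)=-t$, $\sigma_{a,b}(D)=-D+a+\partial_\theta\theta$, $\sigma_{a,b}(\theta)=b\,t\,\partial_\theta$, $\sigma_{a,b}(\partial_\theta)=-(bt)^{-1}\theta$; 2) $\sigma_{++,a}(t)=t$, $\sigma_{++,a}(D)=-D+a$, $\sigma_{++,a}(\theta)=\theta$, $\sigma_{++,a}(\partial_\theta)=-\partial_\theta$; 3) $\sigma_{+-,a}(t)=t$, $\sigma_{+-,a}(D)=-D+a$, $\sigma_{+-,a}(\theta)=-\theta$, $\sigma_{+-,a}(\partial_\theta)=\partial_\theta$; 4) $\sigma_{-+,a}(t)=-t$, $\sigma_{-+,a}(D)=-D+a$, $\sigma_{-+,a}(\theta)=\theta$, $\sigma_{-+,a}(\partial_\theta)=-\partial_\theta$; 5) $\sigma_{--,a}(t)=-t$, $\sigma_{--,a}(D)=-D+a$, $\sigma_{--,a}(\theta)=-\theta$, $\sigma_{--,a}(\partial_\theta)=\partial_\theta$.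
   Context: $\mathcal{SD}_{as}$ is the associative superalgebra over $\mathbb C$ of regular differential operators on the super circle $S^{1|1}$. It is generated by even elements $t,t^{-1},D=t\frac{d}{dt}$ and odd elements $\theta,\partial_\theta$, with $f(D)t=tf(D+1)$ for $f\in\mathbb C[w]$, $\theta^2=\partial_\theta^2=0$, $\theta\partial_\theta+\partial_\theta\theta=1$, and $\theta,\partial_\theta$ commuting with $t$ and $D$. A linear basis is $t^kD^l\theta\partial_\theta,\ t^kD^l\partial_\theta\theta,\ t^kD^l\theta,\ t^kD^l\partial_\theta$ ($k\in\mathbb Z$, $l\ge 0$). The principal gradation is the $\frac12\mathbb Z$-gradation with weights $wt(D)=0$, $wt(t)=1$, $wt(\theta)=\frac12$, $wt(\partial_\theta)=-\frac12$. An anti-involution of $\mathcal{SD}_{as}$ is a $\mathbb C$-linear map $\sigma$ with $\sigma^2=\mathrm{Id}$ and $\sigma(XY)=(-1)^{|X||Y|}\sigma(Y)\sigma(X)$ for homogeneous $X,Y$ of parities $|X|,|Y|$. It preserves the principal gradation if it maps every graded subspace to itself. *)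

(* Defs.v *)
From HB Require Import structures.
From mathcomp Require Import all_boot all_order all_algebra.
From mathcomp Require Import finmap.
From mathcomp Require Import monalg.
From mathcomp Require Import reals complex.

Set Implicit Arguments.
Unset Strict Implicit.
Unset Printing Implicit Defensive.

Import Order.TTheory GRing.Theory Num.Theory.

Local Open Scope ring_scope.

(* The superalgebra SD_as of regular differential operators on S^{1|1}, over  *)
(* a field K.  In the basis t^k D^l theta d, t^k D^l d theta, t^k D^l theta,  *)
(* t^k D^l d (d = partial_theta), an element is a finite sum of t^k M_k(D)    *)
(* with M_k a 2 x 2 matrix over K[w], whose entries collect the coefficients  *)
(* of                                                                         *)
(*              ( theta d   theta   )                                         *)
(*              (    d      d theta )                                         *)
(* The relations theta^2 = d^2 = 0, theta d + d theta = 1 say that these four *)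
(* elements are matrix units, and f(D) t = t f(D + 1) gives                   *)
(*        t^k M(D) * t^l N(D) = t^(k + l) M(D + l) N(D).                      *)
(* The defining relations are proved below, as is the linear basis property   *)
(* (sd_coef_mon and sd_expand).                                               *)

Section Shift.
Variable K : fieldType.

Definition shiftp (l : int) (p : {poly K}) : {poly K} :=
  p \Po ('X + (l%:~R)%:P).

Definition shiftmx (l : int) (M : 'M[{poly K}]_2) : 'M[{poly K}]_2 :=
  map_mx (shiftp l) M.

Lemma shiftp_zmod l : zmod_morphism (shiftp l).
Proof. by move=> p q; rewrite /shiftp rmorphB. Qed.

Lemma shiftp_monoid l : monoid_morphism (shiftp l).
Proof. by split=> [|p q]; rewrite /shiftp ?rmorph1 ?rmorphM. Qed.

HB.instance Definition _ l :=
  GRing.isZmodMorphism.Build {poly K} {poly K} (shiftp l) (shiftp_zmod l).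
HB.instance Definition _ l :=
  GRing.isMonoidMorphism.Build {poly K} {poly K} (shiftp l) (shiftp_monoid l).

Lemma shiftp0 p : shiftp 0 p = p.
Proof. by rewrite /shiftp addr0 comp_polyXr. Qed.

Lemma shiftpD k l p : shiftp k (shiftp l p) = shiftp (l + k) p.
Proof.
rewrite /shiftp -comp_polyA comp_polyD comp_polyX comp_polyC.
by rewrite intrD polyCD -!addrA [X in 'X + X]addrC.
Qed.

Lemma shiftpC l c : shiftp l c%:P = c%:P.
Proof. by rewrite /shiftp comp_polyC. Qed.

Lemma shiftmx0 M : shiftmx 0 M = M.
Proof. by apply/matrixP=> i j; rewrite mxE shiftp0. Qed.

Lemma shiftmxD k l M : shiftmx k (shiftmx l M) = shiftmx (l + k) M.
Proof. by apply/matrixP=> i j; rewrite !mxE shiftpD. Qed.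

Lemma shiftmxM l M N : shiftmx l (M *m N) = shiftmx l M *m shiftmx l N.
Proof. exact: map_mxM. Qed.

Lemma shiftmx1 l : shiftmx l 1%:M = 1%:M.
Proof. exact: map_mx1. Qed.

Lemma shiftmxB l M N : shiftmx l (M - N) = shiftmx l M - shiftmx l N.
Proof. exact: map_mxB. Qed.

Lemma shiftmxDr l M N : shiftmx l (M + N) = shiftmx l M + shiftmx l N.
Proof. exact: map_mxD. Qed.

Lemma shiftmx_0 l : shiftmx l 0 = 0.
Proof. exact: map_mx0. Qed.

Lemma shiftmxC l (c : K) : shiftmx l (c%:P)%:M = (c%:P)%:M.
Proof. by rewrite /shiftmx map_scalar_mx /= shiftpC. Qed.

Lemma shiftmx_delta l i j : shiftmx l (delta_mx i j) = delta_mx i j.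
Proof. exact: map_delta_mx. Qed.

End Shift.

Definition SDas (K : fieldType) : Type := {malg 'M[{poly K}]_2[int]}.

Section Ring.
Variable K : fieldType.

HB.instance Definition _ := GRing.Zmodule.on (SDas K).

Implicit Types (X Y Z : SDas K) (k l : int) (M N : 'M[{poly K}]_2).

Definition sd_mul X Y : SDas K :=
  \sum_(k <- msupp X) \sum_(l <- msupp Y)
     << shiftmx l X@_k *m Y@_l *g k + l >>.

Definition sd_one : SDas K := << 1%:M *g 0 >>.

Definition sd_scale (c : K) X : SDas K := (c%:P)%:M *: (X : {malg _[int]}).

Lemma sd_mulw (d1 d2 : {fset int}) X Y :
  (msupp X `<=` d1)%fset -> (msupp Y `<=` d2)%fset ->
  sd_mul X Y =
  \sum_(k <- d1) \sum_(l <- d2) << shiftmx l X@_k *m Y@_l *g k + l >>.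
Proof.
move=> le_d1 le_d2; rewrite /sd_mul (big_fset_incl _ le_d1) /=.
  apply/eq_bigr=> k1 _; apply/big_fset_incl => // k _ /mcoeff_outdom ->.
  by rewrite mulmx0 monalgU0.
move=> k _ /mcoeff_outdom g1k.
by rewrite big1 => // k' _; rewrite g1k shiftmx_0 mul0mx monalgU0.
Qed.

Lemma sd_mulUU M N k l :
  sd_mul << M *g k >> << N *g l >> = << shiftmx l M *m N *g k + l >>.
Proof.
by rewrite (sd_mulw msuppU_le msuppU_le) !big_seq_fset1 !mcoeffUU.
Qed.

Lemma sd_mulDl : left_distributive sd_mul +%R.
Proof.
move=> X Y Z.
rewrite (@sd_mulw (msupp X `|` msupp Y)%fset (msupp Z) X Z) ?fsubsetUl //.
rewrite (@sd_mulw (msupp X `|` msupp Y)%fset (msupp Z) Y Z) ?fsubsetUr //.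
rewrite (@sd_mulw (msupp X `|` msupp Y)%fset (msupp Z) (X + Y)) ?msuppD_le //.
rewrite -big_split /=; apply/eq_bigr=> k _.
rewrite -big_split /=; apply/eq_bigr=> l _.
by rewrite mcoeffD shiftmxDr mulmxDl monalgUD.
Qed.

Lemma sd_mulDr : right_distributive sd_mul +%R.
Proof.
move=> Z X Y.
rewrite (@sd_mulw (msupp Z) (msupp X `|` msupp Y)%fset Z X) ?fsubsetUl //.
rewrite (@sd_mulw (msupp Z) (msupp X `|` msupp Y)%fset Z Y) ?fsubsetUr //.
rewrite (@sd_mulw (msupp Z) (msupp X `|` msupp Y)%fset Z (X + Y)) ?msuppD_le //.
rewrite -big_split /=; apply/eq_bigr=> k _.
rewrite -big_split /=; apply/eq_bigr=> l _.
by rewrite mcoeffD mulmxDr monalgUD.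
Qed.

Lemma sd_mul0l : left_zero 0 sd_mul.
Proof. by move=> X; rewrite /sd_mul msupp0 big_seq_fset0. Qed.

Lemma sd_mul0r : right_zero 0 sd_mul.
Proof.
by move=> X; rewrite /sd_mul big1 // => k _; rewrite msupp0 big_seq_fset0.
Qed.

Lemma sd_ind (P : SDas K -> Prop) :
  P 0 -> (forall X Y, P X -> P Y -> P (X + Y)) ->
  (forall M k, P << M *g k >>) -> forall X, P X.
Proof. by move=> P0 PD PU X; rewrite (monalgE X); apply: big_ind. Qed.

Lemma sd_mulA : associative sd_mul.
Proof.
move=> X Y Z; elim/sd_ind: X => [|X1 X2 IH1 IH2|L k].
- by rewrite !sd_mul0l.
- by rewrite !sd_mulDl IH1 IH2.
elim/sd_ind: Y => [|Y1 Y2 IH1 IH2|M l].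
- by rewrite !(sd_mul0l, sd_mul0r).
- by rewrite !(sd_mulDl, sd_mulDr) IH1 IH2.
elim/sd_ind: Z => [|Z1 Z2 IH1 IH2|N m].
- by rewrite !sd_mul0r.
- by rewrite !sd_mulDr IH1 IH2.
by rewrite !sd_mulUU shiftmxM shiftmxD mulmxA addrA.
Qed.

Lemma sd_mul1l : left_id sd_one sd_mul.
Proof.
elim/sd_ind=> [|X1 X2 IH1 IH2|L k]; first by rewrite sd_mul0r.
  by rewrite sd_mulDr IH1 IH2.
by rewrite sd_mulUU shiftmx1 mul1mx add0r.
Qed.

Lemma sd_mul1r : right_id sd_one sd_mul.
Proof.
elim/sd_ind=> [|X1 X2 IH1 IH2|L k]; first by rewrite sd_mul0l.
  by rewrite sd_mulDl IH1 IH2.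
by rewrite sd_mulUU shiftmx0 mulmx1 addr0.
Qed.

Lemma sd_one_neq0 : sd_one != 0.
Proof. by rewrite monalgU_eq0 (oner_neq0 ('M[{poly K}]_2)). Qed.

HB.instance Definition _ := GRing.Zmodule_isNzRing.Build (SDas K)
  sd_mulA sd_mul1l sd_mul1r sd_mulDl sd_mulDr sd_one_neq0.

Lemma sd_scaleA a b X : sd_scale a (sd_scale b X) = sd_scale (a * b) X.
Proof. by rewrite /sd_scale scalerA polyCM scalar_mxM. Qed.

Lemma sd_scale1 : left_id 1 sd_scale.
Proof. by move=> X; rewrite /sd_scale scale1r. Qed.

Lemma sd_scaleDr : right_distributive sd_scale +%R.
Proof. by move=> c X Y; rewrite /sd_scale scalerDr. Qed.

Lemma sd_scaleDl X : {morph sd_scale^~ X : a b / a + b}.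
Proof.
by move=> a b; rewrite /sd_scale polyCD raddfD /= scalerDl.
Qed.

HB.instance Definition _ := GRing.Zmodule_isLmodule.Build K (SDas K)
  sd_scaleA sd_scale1 sd_scaleDr sd_scaleDl.

Lemma sd_scaleU (c : K) M k :
  c *: (<< M *g k >> : SDas K) = << (c%:P)%:M *m M *g k >>.
Proof.
apply/malgP=> l; rewrite [LHS](@mcoeffZ int 'M[{poly K}]_2) !mcoeffU.
by rewrite mulrnAr.
Qed.

Lemma sd_mulE M N k l :
  (<< M *g k >> : SDas K) * << N *g l >> = << shiftmx l M *m N *g k + l >>.
Proof. exact: sd_mulUU. Qed.

Lemma sd_scaleAl (c : K) X Y : c *: (X * Y) = c *: X * Y.
Proof.
elim/sd_ind: X => [|X1 X2 IH1 IH2|M k]; first by rewrite !(mul0r, scaler0).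
  by rewrite mulrDl !scalerDr mulrDl IH1 IH2.
elim/sd_ind: Y => [|Y1 Y2 IH1 IH2|N l]; first by rewrite !(mulr0, scaler0).
  by rewrite !mulrDr scalerDr IH1 IH2.
by rewrite sd_mulE !sd_scaleU sd_mulE shiftmxM shiftmxC mulmxA.
Qed.

HB.instance Definition _ := GRing.Lmodule_isLalgebra.Build K (SDas K) sd_scaleAl.

Lemma sd_scaleAr (c : K) X Y : c *: (X * Y) = X * (c *: Y).
Proof.
elim/sd_ind: X => [|X1 X2 IH1 IH2|M k]; first by rewrite !(mul0r, scaler0).
  by rewrite !mulrDl scalerDr IH1 IH2.
elim/sd_ind: Y => [|Y1 Y2 IH1 IH2|N l]; first by rewrite !(mulr0, scaler0).
  by rewrite mulrDr !scalerDr mulrDr IH1 IH2.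
rewrite sd_mulE !sd_scaleU sd_mulE; congr << _ *g _ >>.
by rewrite mul_scalar_mx mul_scalar_mx scalemxAr.
Qed.

HB.instance Definition _ := GRing.Lalgebra_isAlgebra.Build K (SDas K) sd_scaleAr.

End Ring.

Section Generators.
Variable K : fieldType.

Definition sd_t : SDas K := << 1%:M *g 1 >>.
Definition sd_tinv : SDas K := << 1%:M *g - 1 >>.
Definition sd_D : SDas K := << ('X)%:M *g 0 >>.
Definition sd_theta : SDas K := << delta_mx 0 1 *g 0 >>.
Definition sd_dtheta : SDas K := << delta_mx 1 0 *g 0 >>.

Lemma sd_mul_t_tinv : sd_t * sd_tinv = 1.
Proof. by rewrite sd_mulE shiftmx1 mulmx1. Qed.

Lemma sd_mul_tinv_t : sd_tinv * sd_t = 1.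
Proof. by rewrite sd_mulE shiftmx1 mulmx1. Qed.

Lemma sd_DE (f : {poly K}) : horner_alg sd_D f = << f%:M *g 0 >>.
Proof.
elim/poly_ind: f => [|f c IH].
  by rewrite raddf0 raddf0 monalgU0.
rewrite rmorphD rmorphM /= horner_algX horner_algC IH sd_mulE shiftmx0 addr0.
rewrite sd_scaleU mulmx1 -monalgUD; congr << _ *g _ >>.
by rewrite -scalar_mxM -raddfD.
Qed.

Lemma sd_relD (f : {poly K}) :
  horner_alg sd_D f * sd_t = sd_t * horner_alg (sd_D + 1) f.
Proof.
elim/poly_ind: f => [|f c IH].
  by rewrite !raddf0 mul0r mulr0.
have Dt : sd_D * sd_t = sd_t * (sd_D + 1).
  rewrite mulrDr mulr1 !sd_mulE shiftmx1 mul1mx mulmx1 addr0 add0r -monalgUD.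
  congr << _ *g _ >>; rewrite /shiftmx map_scalar_mx /= /shiftp comp_polyX.
  by rewrite -raddfD.
rewrite !rmorphD !rmorphM /= !horner_algX !horner_algC.
rewrite mulrDl -mulrA Dt mulrA IH [in RHS]mulrDr [in RHS]mulrA; congr (_ + _).
by rewrite -scalerAl mul1r -scalerAr mulr1.
Qed.

Lemma sd_theta2 : sd_theta * sd_theta = 0.
Proof. by rewrite sd_mulE shiftmx0 mul_delta_mx_0 ?monalgU0. Qed.

Lemma sd_dtheta2 : sd_dtheta * sd_dtheta = 0.
Proof. by rewrite sd_mulE shiftmx0 mul_delta_mx_0 ?monalgU0. Qed.

Lemma sd_theta_dtheta :
  sd_theta * sd_dtheta = << delta_mx 0 0 *g 0 >>.
Proof. by rewrite sd_mulE shiftmx0 mul_delta_mx addr0. Qed.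

Lemma sd_dtheta_theta :
  sd_dtheta * sd_theta = << delta_mx 1 1 *g 0 >>.
Proof. by rewrite sd_mulE shiftmx0 mul_delta_mx addr0. Qed.

Lemma sd_clifford : sd_theta * sd_dtheta + sd_dtheta * sd_theta = 1.
Proof.
rewrite sd_theta_dtheta sd_dtheta_theta -monalgUD; congr << _ *g _ >>.
rewrite (mx1_sum_delta ({poly K}) 2) big_ord_recl big_ord1.
by congr (_ + delta_mx _ _); apply/val_inj.
Qed.

Lemma sd_theta_t : sd_theta * sd_t = sd_t * sd_theta.
Proof. by rewrite !sd_mulE shiftmx1 shiftmx_delta mul1mx mulmx1 addrC. Qed.

Lemma sd_dtheta_t : sd_dtheta * sd_t = sd_t * sd_dtheta.
Proof. by rewrite !sd_mulE shiftmx1 shiftmx_delta mul1mx mulmx1 addrC. Qed.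

Lemma sd_theta_D : sd_theta * sd_D = sd_D * sd_theta.
Proof. by rewrite !sd_mulE !shiftmx0 scalar_mxC. Qed.

Lemma sd_dtheta_D : sd_dtheta * sd_D = sd_D * sd_dtheta.
Proof. by rewrite !sd_mulE !shiftmx0 scalar_mxC. Qed.

Definition sd_tpow (k : int) : SDas K :=
  match k with Posz n => sd_t ^+ n | Negz n => sd_tinv ^+ n.+1 end.

Definition sd_unit (i j : 'I_2) : SDas K :=
  if i == 0 then if j == 0 then sd_theta * sd_dtheta else sd_theta
  else if j == 0 then sd_dtheta else sd_dtheta * sd_theta.

Definition sd_mon (k : int) (l : nat) (i j : 'I_2) : SDas K :=
  sd_tpow k * sd_D ^+ l * sd_unit i j.

Definition sd_entry (X : SDas K) (k : int) (i j : 'I_2) : {poly K} :=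
  (mcoeff k X : 'M_2) i j.

Definition sd_coef (X : SDas K) (k : int) (l : nat) (i j : 'I_2) : K :=
  (sd_entry X k i j)`_l.

Lemma sd_tpowE k : sd_tpow k = << 1%:M *g k >>.
Proof.
case: k => n /=.
  elim: n => [//|n IH]; rewrite exprS IH sd_mulE shiftmx1 mulmx1.
  by rewrite -intS.
elim: n => [//|n IH]; rewrite exprS IH sd_mulE shiftmx1 mulmx1.
by congr << _ *g _ >>; rewrite !NegzE [in RHS]intS opprD.
Qed.

Lemma sd_unitE i j : sd_unit i j = << delta_mx i j *g 0 >>.
Proof.
rewrite /sd_unit sd_theta_dtheta sd_dtheta_theta.
by case: (unliftP 0 i) => [i' ->|->]; case: (unliftP 0 j) => [j' ->|->] /=;
  rewrite ?[i']ord1 ?[j']ord1 /=; congr << delta_mx _ _ *g _ >>; apply/val_inj.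
Qed.

Lemma sd_monE k l i j : sd_mon k l i j = << 'X^l *: delta_mx i j *g k >>.
Proof.
rewrite /sd_mon; have -> : sd_D ^+ l = << ('X^l)%:M *g 0 >>.
  by rewrite -sd_DE rmorphXn /= horner_algX.
rewrite sd_tpowE sd_unitE !sd_mulE !shiftmx0 mul1mx !addr0.
by rewrite mul_scalar_mx.
Qed.

Lemma sd_coef_mon k l i j k' l' i' j' :
  sd_coef (sd_mon k l i j) k' l' i' j' =
  [&& k == k', l == l', i == i' & j == j']%:R.
Proof.
rewrite /sd_coef /sd_entry sd_monE mcoeffU; case: (k == k'); last by rewrite mxE coef0.
rewrite mulr1n !mxE [i' == i]eq_sym [j' == j]eq_sym.
case: (i == i'); case: (j == j');
  rewrite /= ?mulr0 ?mulr1 ?coef0 ?coefXn ?andbF ?andbT //.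
by rewrite eq_sym.
Qed.

Lemma sd_coefD X Y k l i j :
  sd_coef (X + Y) k l i j = sd_coef X k l i j + sd_coef Y k l i j.
Proof. by rewrite /sd_coef /sd_entry mcoeffD mxE coefD. Qed.

Lemma sd_coefZ c X k l i j : sd_coef (c *: X) k l i j = c * sd_coef X k l i j.
Proof.
rewrite /sd_coef /sd_entry [(c *: X)@_k](@mcoeffZ int 'M[{poly K}]_2).
by rewrite [_ * _]mul_scalar_mx mxE coefCM.
Qed.

Lemma sd_expand X :
  X = \sum_(k <- msupp X) \sum_(i < 2) \sum_(j < 2)
        \sum_(l < size (sd_entry X k i j)) sd_coef X k l i j *: sd_mon k l i j.
Proof.
rewrite {1}[X]monalgE; apply/eq_bigr=> k _.
rewrite {1}[mcoeff k X]matrix_sum_delta raddf_sum; apply/eq_bigr=> i _ /=.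
rewrite raddf_sum; apply/eq_bigr=> j _ /=.
rewrite -[X in X *: _]coefK -/(sd_entry X k i j) poly_def scaler_suml raddf_sum; apply/eq_bigr=> l _ /=.
rewrite sd_monE sd_scaleU mul_scalar_mx scalerA mul_polyC.
by [].
Qed.

End Generators.

Section Gradings.
Variable K : fieldType.
Implicit Types X Y : SDas K.

(* theta d and d theta (i = j) are even, theta and d (i != j) are odd. *)
Definition sd_parity (p : bool) X : Prop :=
  forall k l i j, sd_coef X k l i j != 0 -> (i != j) = p.

(* Weight of t^k D^l e_ij, where e_01 = theta has weight 1/2 and              *)
(* e_10 = partial_theta has weight - 1/2.                                     *)
Definition sd_wt (k : int) (i j : 'I_2) : rat :=
  k%:~R + ((j : nat)%:R - (i : nat)%:R) / 2.

Definition sd_graded (w : rat) X : Prop :=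
  forall k l i j, sd_coef X k l i j != 0 -> sd_wt k i j = w.

Lemma sd_entry_mulU X Y n i j :
  sd_entry (X * Y) n i j =
  \sum_(k <- msupp X) \sum_(l <- msupp Y)
    (\sum_m shiftp l (sd_entry X k i m) * sd_entry Y l m j) *+ (k + l == n).
Proof.
rewrite /sd_entry [X * Y]/(sd_mul X Y) /sd_mul raddf_sum summxE.
apply/eq_bigr=> k _; rewrite raddf_sum summxE; apply/eq_bigr=> l _ /=.
rewrite mcoeffU; case: (k + l == n); rewrite ?mulr0n ?mulr1n !mxE //.
by apply/eq_bigr=> m _; rewrite mxE.
Qed.

Lemma sd_homogM (T : eqType) (op : T -> T -> T) (d : int -> 'I_2 -> 'I_2 -> T) :
  (forall k l i m j, d (k + l) i j = op (d k i m) (d l m j)) ->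
  forall u v X Y,
  (forall k l i j, sd_coef X k l i j != 0 -> d k i j = u) ->
  (forall k l i j, sd_coef Y k l i j != 0 -> d k i j = v) ->
  forall k l i j, sd_coef (X * Y) k l i j != 0 -> d k i j = op u v.
Proof.
move=> dM u v X Y hX hY.
have entry0 (Z : SDas K) w : (forall k l i j, sd_coef Z k l i j != 0 -> d k i j = w) ->
    forall k i j, d k i j != w -> sd_entry Z k i j = 0.
  move=> hZ k i j; apply: contra_neq_eq => nz; apply: (hZ k (size (sd_entry Z k i j)).-1 i j).
  by rewrite [sd_coef _ _ _ _ _]/(lead_coef _) lead_coef_eq0.
move=> n l0 i j; apply: contra_neq_eq => dn.
rewrite /sd_coef sd_entry_mulU.
rewrite big1 ?coef0 // => k _; rewrite big1 // => l _.
case: eqP => [kl|//]; rewrite mulr1n big1 // => m _.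
have [dk|/(entry0 _ _ hX) ->] := eqVneq (d k i m) u; last by rewrite raddf0 mul0r.
have [dl|/(entry0 _ _ hY) ->] := eqVneq (d l m j) v; last by rewrite mulr0.
by move: dn; rewrite -kl (dM k l i m j) dk dl eqxx.
Qed.

Lemma sd_parityM p q X Y :
  sd_parity p X -> sd_parity q Y -> sd_parity (p (+) q) (X * Y).
Proof.
apply: (sd_homogM (d := fun _ i j => i != j)) => _ _ i m j.
by case: (unliftP 0 i) => [? ->|->]; case: (unliftP 0 m) => [? ->|->];
  case: (unliftP 0 j) => [? ->|->]; rewrite ?ord1.
Qed.

Lemma sd_gradedM v w X Y :
  sd_graded v X -> sd_graded w Y -> sd_graded (v + w) (X * Y).
Proof.
apply: sd_homogM => k l i m j; rewrite /sd_wt intrD.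
by rewrite addrACA -mulrDl; congr (_ + _ / _); rewrite [RHS]addrC subrKA.
Qed.

Definition preserves_principal_gradation (s : SDas K -> SDas K) : Prop :=
  forall w X, sd_graded w X -> sd_graded w (s X).

Definition anti_involution (s : SDas K -> SDas K) : Prop :=
  [/\ linear s,
      involutive s
    & forall p q X Y, sd_parity p X -> sd_parity q Y ->
        s (X * Y) = (-1) ^+ (p && q) *: (s Y * s X)].

End Gradings.

(* Main.v *)
Require Import Defs.
From mathcomp Require Import all_boot all_order all_algebra.
From mathcomp Require Import monalg zify ring.
From mathcomp Require Import reals complex.

Set Implicit Arguments.
Unset Strict Implicit.
Unset Printing Implicit Defensive.

Import GRing.Theory.
Local Open Scope ring_scope.

(** Everything is decided in weight 0, and then propagates along the gradation.

    Let e_0 = theta d and e_1 = d theta, with d = partial_theta; these are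
    orthogonal idempotents of sum 1.  The part of weight 0 is the commutative
    ring K[D] e_0 + K[D] e_1, a product of two domains, and an anti-involution
    s preserving the gradation restricts to an automorphism of it.  The only
    idempotents being 0, 1, e_0 and e_1, either s fixes both e_i or it
    exchanges them (anti_idempotent0).

    Since theta = e_0 theta e_1, the image of theta is s(e_1) s(theta) s(e_0):
    it lies in a single matrix corner, where the weight 1/2 leaves only one
    power of t (anti_corner).  So s(theta) is g(D) times a fixed monomial, and
    likewise for d; applying s to theta d = e_0 shows that g is invertible in
    K[D], hence constant (anti_odd_generators).

    As t is invertible of weight 1, s(t) = t (p_0 e_0 + p_1 e_1) with constant
    p_i, and commutation with theta gives p_0 = p_1; s^2 = 1 makes this constant
    a square root of 1.  Applying s to D t = t (D + 1) says that each component
    f of s(D) satisfies f(w + 1) = f(w) - 1, so that f(w) = a - w in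
    characteristic 0; commutation of D with theta relates the two constants a
    (anti_even_generators).

    If s fixes the e_i then s(theta) = b t d, and s(s(theta)) = theta forces
    s(t) = - t: this is the family with two parameters.  If s exchanges them
    then s(theta) = b theta with b = 1 or -1, and the two independent signs
    give the other four families. *)

Lemma ord2_cases (P : 'I_2 -> Prop) : P 0 -> P 1 -> forall i, P i.
Proof.
move=> P0 P1 i; have [j ->|->//] := unliftP 0 i.
by rewrite ord1; have -> : lift 0 0 = 1 :> 'I_2 by apply/val_inj.
Qed.

(** * Polynomials under the shift w |-> w + 1 *)

Section Shifts.
Variable K : fieldType.
Implicit Types f : {poly K}.

Lemma horner_shiftp_invariant n f : shiftp 1 f = f -> f.[n%:R] = f.[0].
Proof.
move=> fE; elim: n => [//|n IH]; rewrite -IH -[in RHS]fE.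
by rewrite /shiftp horner_comp hornerD hornerX hornerC -natr1.
Qed.

(** In characteristic 0 the naturals are infinitely many roots of f - f(0). *)
Lemma shiftp_invariant f : [pchar K] =i pred0 -> shiftp 1 f = f -> f = (f.[0])%:P.
Proof.
move=> /pcharf0P char0 fE; apply/eqP; rewrite -subr_eq0; apply/eqP.
set g := f - _; apply: (@roots_geq_poly_eq0 _ g [seq n%:R | n <- iota 0 (size g)]).
- apply/allP=> _ /mapP[n _ ->]; rewrite /root /g hornerD hornerN hornerC.
  by rewrite horner_shiftp_invariant // subrr.
- rewrite map_inj_uniq ?iota_uniq // => m n /eqP.
  wlog le_mn : m n / (m <= n)%N => [WH|].
    by case/orP: (leq_total m n) => le /eqP e; [|apply/esym]; apply: WH le _; rewrite e.
  rewrite eq_sym -subr_eq0 -natrB // char0 subn_eq0 => le_nm.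
  by apply/eqP; rewrite eqn_leq le_mn.
- by rewrite size_map size_iota.
Qed.

Lemma shiftp_decrement f : [pchar K] =i pred0 -> shiftp 1 f + 1 = f ->
  exists a, f = a%:P - 'X.
Proof.
move=> char0 fE; exists ((f + 'X).[0]).
rewrite -shiftp_invariant ?addrK //.
by rewrite raddfD /= [shiftp 1 'X]/shiftp comp_polyX -[in RHS]fE addrA addrAC.
Qed.

End Shifts.

(** * Matrix units with polynomial coefficients *)

Section Entries.
Variable K : fieldType.
Implicit Types (f g : {poly K}) (F G : 'I_2 -> {poly K}) (X Y : SDas K).

(** t^k f(D) e_ij, where e_01 = theta and e_10 = partial_theta. *)
Definition sd_elt f (k : int) (i j : 'I_2) : SDas K := << f *: delta_mx i j *g k >>.

(** t^k (F_0(D) theta d + F_1(D) d theta): the shape of the elements of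
    integral weight k. *)
Definition sd_diag F (k : int) : SDas K := << diag_mx (\row_i F i) *g k >>.

Lemma sd_entryP X Y : (forall k i j, sd_entry X k i j = sd_entry Y k i j) -> X = Y.
Proof. by move=> XY; apply/malgP=> k; apply/matrixP=> i j; exact: XY. Qed.

Lemma sd_entryD X Y k i j : sd_entry (X + Y) k i j = sd_entry X k i j + sd_entry Y k i j.
Proof. by rewrite /sd_entry mcoeffD mxE. Qed.

Lemma sd_entryU (M : 'M[{poly K}]_2) k l i j :
  sd_entry (<< M *g k >> : SDas K) l i j = M i j *+ (k == l).
Proof. by rewrite /sd_entry mcoeffU; case: (k == l); rewrite // mxE. Qed.

Lemma sd_entry_elt f k i j l i' j' :
  sd_entry (sd_elt f k i j) l i' j' =
  f *+ [&& k == l, i' == i & j' == j].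
Proof.
rewrite sd_entryU !mxE; case: (k == l); case: (_ && _); by rewrite ?mulr1 ?mulr0.
Qed.

Lemma sd_entry_diag F k l i j :
  sd_entry (sd_diag F k) l i j = F i *+ ((k == l) && (i == j)).
Proof.
by rewrite sd_entryU !mxE; case: (k == l); case: eqP => [->|].
Qed.

Lemma sd_elt_inj f g k i j : sd_elt f k i j = sd_elt g k i j -> f = g.
Proof.
by move/(congr1 (fun X => sd_entry X k i j)); rewrite !sd_entry_elt !eqxx.
Qed.

Lemma sd_diag_inj F G k : sd_diag F k = sd_diag G k -> forall i, F i = G i.
Proof.
move=> e i; move/(congr1 (fun X => sd_entry X k i i)): e.
by rewrite !sd_entry_diag !eqxx.
Qed.

Lemma eq_sd_diag F G k : (forall i, F i = G i) -> sd_diag F k = sd_diag G k.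
Proof. by move=> e; apply/sd_entryP=> l i j; rewrite !sd_entry_diag e. Qed.

Lemma sd_eltM f g k l i j m :
  sd_elt f k i j * sd_elt g l j m = sd_elt (shiftp l f * g) (k + l) i m.
Proof.
rewrite sd_mulE; congr << _ *g _ >>.
have -> : shiftmx l (f *: delta_mx i j) = shiftp l f *: delta_mx i j.
  by apply/matrixP=> a b; rewrite !mxE rmorphM /= rmorph_nat.
by rewrite -scalemxAl -scalemxAr scalerA mul_delta_mx.
Qed.

Lemma shiftmx_diag l F :
  shiftmx l (diag_mx (\row_i F i)) = diag_mx (\row_i shiftp l (F i)).
Proof. by apply/matrixP=> i j; rewrite !mxE raddfMn. Qed.

Lemma sd_diagM F G k l :
  sd_diag F k * sd_diag G l = sd_diag (fun i => shiftp l (F i) * G i) (k + l).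
Proof.
rewrite sd_mulE shiftmx_diag mulmx_diag; congr << diag_mx _ *g _ >>.
by apply/rowP=> i; rewrite !mxE.
Qed.

Lemma sd_diag_eltM F g k l i j :
  sd_diag F k * sd_elt g l i j = sd_elt (shiftp l (F i) * g) (k + l) i j.
Proof.
rewrite sd_mulE shiftmx_diag mul_diag_mx; congr << _ *g _ >>.
apply/matrixP=> a b; rewrite !mxE.
by have [->|] := eqVneq a i; rewrite ?mulrA //= !mulr0.
Qed.

Lemma sd_elt_diagM F g k l i j :
  sd_elt g l i j * sd_diag F k = sd_elt (shiftp k g * F j) (l + k) i j.
Proof.
rewrite sd_mulE mul_mx_diag; congr << _ *g _ >>.
apply/matrixP=> a b; rewrite !mxE rmorphM rmorph_nat.
have [->|] := eqVneq b j; last by rewrite andbF !mulr0 mul0r.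
by rewrite mulrAC.
Qed.

Lemma sd_diagD F G k : sd_diag F k + sd_diag G k = sd_diag (fun i => F i + G i) k.
Proof.
apply/sd_entryP=> l i j; rewrite sd_entryD.
by rewrite !sd_entry_diag mulrnDl.
Qed.

Lemma sd_elt_polyC (c : K) k i j : sd_elt c%:P k i j = c *: sd_elt 1 k i j.
Proof. by rewrite sd_scaleU mul_scalar_mx scale1r. Qed.

Lemma sd_diagZ (c : K) F k : c *: sd_diag F k = sd_diag (fun i => c%:P * F i) k.
Proof.
rewrite sd_scaleU mul_scalar_mx; congr << _ *g _ >>.
by apply/matrixP=> i j; rewrite !mxE mulrnAr.
Qed.

Lemma sd_thetaE : sd_theta K = sd_elt 1 0 0 1.
Proof. by rewrite /sd_elt scale1r. Qed.

Lemma sd_dthetaE : sd_dtheta K = sd_elt 1 0 1 0.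
Proof. by rewrite /sd_elt scale1r. Qed.

Lemma sd_theta_dthetaE : sd_theta K * sd_dtheta K = sd_elt 1 0 0 0.
Proof. by rewrite sd_theta_dtheta /sd_elt scale1r. Qed.

Lemma sd_dtheta_thetaE : sd_dtheta K * sd_theta K = sd_elt 1 0 1 1.
Proof. by rewrite sd_dtheta_theta /sd_elt scale1r. Qed.

Lemma sd_scalar_diag f k : << f%:M *g k >> = sd_diag (fun=> f) k.
Proof.
apply/sd_entryP=> l i j.
by rewrite sd_entry_diag sd_entryU !mxE -mulrnA mulnb andbC.
Qed.

Lemma sd_tE : sd_t K = sd_diag (fun=> 1) 1.
Proof. exact: sd_scalar_diag. Qed.

Lemma sd_tinvE : sd_tinv K = sd_diag (fun=> 1) (- 1).
Proof. exact: sd_scalar_diag. Qed.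

Lemma sd_DdiagE : sd_D K = sd_diag (fun=> 'X) 0.
Proof. exact: sd_scalar_diag. Qed.

Lemma sd_1E : 1 = sd_diag (fun=> 1) 0.
Proof. exact: sd_scalar_diag. Qed.

Lemma sd_elt_unitE i : sd_elt 1 0 i i = sd_diag (fun j => (j == i)%:R) 0.
Proof.
apply/sd_entryP=> l a b; rewrite sd_entry_elt sd_entry_diag.
case: (0 == l) => //=; have [->|ab] := eqVneq a b; first by rewrite andbb.
by move: ab; have [->|_] := eqVneq a i => ab; rewrite ?mul0rn // eq_sym (negPf ab).
Qed.

End Entries.

(** * Shape of the homogeneous elements *)

Section Gradings.
Variable K : fieldType.
Implicit Types (f g : {poly K}) (F : 'I_2 -> {poly K}) (X Y : SDas K).

Lemma sd_parity_elt f k i j : sd_parity (i != j) (sd_elt f k i j).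
Proof.
move=> l m i' j'; rewrite /sd_coef sd_entry_elt; case: and3P => [[_ /eqP-> /eqP->] //|_].
by rewrite coef0 eqxx.
Qed.

Lemma sd_graded_elt f k i j : sd_graded (sd_wt k i j) (sd_elt f k i j).
Proof.
move=> l m i' j'; rewrite /sd_coef sd_entry_elt.
by case: and3P => [[/eqP-> /eqP-> /eqP->] //|_]; rewrite coef0 eqxx.
Qed.

Lemma sd_parity_diag F k : sd_parity false (sd_diag F k).
Proof.
move=> l m i j; rewrite /sd_coef sd_entry_diag.
by case: andP => [[_ ->]//|_]; rewrite coef0 eqxx.
Qed.

Lemma sd_graded_diag F k : sd_graded k%:~R (sd_diag F k).
Proof.
move=> l m i j; rewrite /sd_coef sd_entry_diag.
case: andP => [[/eqP-> /eqP->] _|_]; last by rewrite coef0 eqxx.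
by rewrite /sd_wt subrr mul0r addr0.
Qed.

Lemma sd_graded_entry w X k i j : sd_graded w X -> sd_wt k i j != w -> sd_entry X k i j = 0.
Proof.
move=> Xw; apply: contra_neq_eq => nz; apply: (Xw k (size (sd_entry X k i j)).-1).
by rewrite [sd_coef _ _ _ _ _]/(lead_coef _) lead_coef_eq0.
Qed.

Lemma sd_wt_inj i j : injective (fun k => sd_wt k i j).
Proof. by move=> k l /addIr /intr_inj. Qed.

Lemma sd_wt_int k l i j : sd_wt k i j = l%:~R -> i = j.
Proof.
have two_int (e : int) : k%:~R + e%:~R / 2 = l%:~R :> rat -> k * 2 + e = l * 2.
  move=> /(congr1 ( *%R^~ 2)); rewrite mulrDl divfK //.
  by rewrite -[2]/(2%:~R) -!intrM -intrD => /intr_inj.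
rewrite /sd_wt; move: i j; apply: ord2_cases; apply: ord2_cases => //=.
  by rewrite subr0 => /(two_int 1); lia.
by rewrite sub0r => /(two_int (-1)); lia.
Qed.

(** The off-diagonal units have weight 1/2 or - 1/2, so integral weight leaves
    only the diagonal ones, of weight 0, and the weight is the power of t. *)
Lemma sd_graded_intE k X :
  sd_graded k%:~R X -> X = sd_diag (fun i => sd_entry X k i i) k.
Proof.
move=> Xk; apply/sd_entryP=> l i j; rewrite sd_entry_diag.
have [<-|ij] := eqVneq i j; last first.
  rewrite andbF; apply: (sd_graded_entry Xk); apply: contra_neq ij; exact: sd_wt_int.
have [<-//|kl] := eqVneq k l.
apply: (sd_graded_entry Xk); apply: contra_neq kl.
by rewrite /sd_wt subrr mul0r addr0 => /intr_inj.
Qed.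

(** In the corner e_i A e_j different powers of t have different weights, so a
    homogeneous element involves only one of them. *)
Lemma sd_cornerE w X k i j : sd_graded w X -> sd_wt k i j = w ->
  sd_elt 1 0 i i * X * sd_elt 1 0 j j = sd_elt (sd_entry X k i j) k i j.
Proof.
move=> Xw kw.
have cornerE l a b : sd_entry (sd_elt 1 0 i i * X * sd_elt 1 0 j j) l a b
    = (a == i)%:R * sd_entry X l a b * (b == j)%:R.
  rewrite !sd_elt_unitE; elim/sd_ind: X {Xw} => [|X Y IHX IHY|M m].
  - by rewrite mulr0 mul0r /sd_entry mcoeff0 mxE mulr0 mul0r.
  - rewrite [in RHS]sd_entryD [in RHS]mulrDr [in RHS]mulrDl -IHX -IHY.
    by rewrite -sd_entryD -mulrDl -mulrDr.
  rewrite !sd_mulE shiftmxM !shiftmx_diag shiftmx0 addr0 add0r mul_mx_diag mul_diag_mx.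
  rewrite !sd_entryU !mxE shiftp0 rmorph_nat.
  by case: (m == l); rewrite !(mulr1n, mulr0n) // mulr0 mul0r.
apply/sd_entryP=> l a b; rewrite sd_entry_elt cornerE.
have [->|_] := eqVneq a i; last by rewrite !mul0r andbF.
have [->|_] := eqVneq b j; last by rewrite mulr0 !andbF.
rewrite mul1r mulr1 !andbT; have [->//|kl] := eqVneq k l.
apply: (sd_graded_entry Xw); apply: contra_neq kl => lw.
by apply: (@sd_wt_inj i j); rewrite kw.
Qed.

End Gradings.

(** * Images of the generators *)

Section AntiInvolutions.
Variables (K : fieldType) (s : SDas K -> SDas K).
Hypotheses (s_anti : anti_involution s) (s_wt : preserves_principal_gradation s).
Implicit Types (X Y : SDas K) (F : 'I_2 -> {poly K}).

Local Notation e i := (sd_elt 1 0 i i : SDas K).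

Lemma anti_linear : linear s. Proof. by case: s_anti. Qed.

Lemma antiK : involutive s. Proof. by case: s_anti. Qed.

Lemma antiD X Y : s (X + Y) = s X + s Y.
Proof. by rewrite -{1}[X]scale1r anti_linear scale1r. Qed.

Lemma anti0 : s 0 = 0.
Proof. by apply: (addrI (s 0)); rewrite -antiD !addr0. Qed.

Lemma antiZ (c : K) X : s (c *: X) = c *: s X.
Proof. by rewrite -[c *: X]addr0 anti_linear anti0 addr0. Qed.

Lemma anti_mul_even_l p X Y :
  sd_parity false X -> sd_parity p Y -> s (X * Y) = s Y * s X.
Proof.
case: s_anti => _ _ sM X0 Yp.
by rewrite (sM _ _ _ _ X0 Yp) expr0 scale1r.
Qed.

Lemma anti_mul_even_r p X Y :
  sd_parity p X -> sd_parity false Y -> s (X * Y) = s Y * s X.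
Proof.
case: s_anti => _ _ sM Xp Y0.
by rewrite (sM _ _ _ _ Xp Y0) andbF expr0 scale1r.
Qed.

Lemma anti_mul_odd X Y :
  sd_parity true X -> sd_parity true Y -> s (X * Y) = - (s Y * s X).
Proof.
case: s_anti => _ _ sM X1 Y1.
by rewrite (sM _ _ _ _ X1 Y1) expr1 scaleN1r.
Qed.

(** The multiplicativity of s is only given up to sign and on homogeneous
    elements, but s 1 has weight 0, hence is even. *)
Lemma anti1 : s 1 = 1.
Proof.
have p1 : sd_parity false (1 : SDas K) by rewrite sd_1E; apply: sd_parity_diag.
have ps : sd_parity false (s 1).
  have : sd_graded 0%:~R (s 1).
    by apply: s_wt; rewrite sd_1E; apply: sd_graded_diag.
  by move=> /sd_graded_intE ->; apply: sd_parity_diag.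
have := anti_mul_even_l ps p1.
by rewrite mulr1 antiK mulr1.
Qed.

Lemma anti_diag F k : exists G, s (sd_diag F k) = sd_diag G k.
Proof.
exists (fun i => sd_entry (s (sd_diag F k)) k i i).
by apply: sd_graded_intE; apply: s_wt; apply: sd_graded_diag.
Qed.

(** K[D] x K[D] has no idempotents besides 0, 1, e_0 and e_1, and injectivity of
    s excludes the first two as images of e_0. *)
Lemma anti_idempotent0 : exists i, s (e 0) = e i.
Proof.
have pe0 : sd_parity false (e 0) by apply: sd_parity_elt.
have [F eF] : exists F, s (e 0) = sd_diag F 0.
  by rewrite sd_elt_unitE; apply: anti_diag.
have e0_neq (i : bool) : e 0 != sd_diag (fun=> i%:R) 0.
  apply/eqP; rewrite sd_elt_unitE => /sd_diag_inj E.
  case: i E => E; first by have /eqP := E 1; rewrite eq_sym oner_eq0.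
  by have /eqP := E 0; rewrite oner_eq0.
have FF i : F i = 0 \/ F i = 1.
  have := anti_mul_even_l pe0 pe0; rewrite sd_eltM shiftp0 mulr1 addr0 eF sd_diagM.
  rewrite addr0 => /sd_diag_inj/(_ i)/eqP.
  rewrite shiftp0 -subr_eq0 -{1}[F i]mulr1 -mulrBr mulf_eq0 subr_eq0.
  by case/orP => /eqP; [left | right].
have sI X : s (e 0) = s X -> e 0 = X by move=> /(congr1 s); rewrite !antiK.
case: (FF 0) (FF 1) => F0 [] F1.
- case/eqP: (e0_neq false); apply: sI; rewrite eF.
  have -> : sd_diag (fun=> false%:R) 0 = 0 :> SDas K.
    by apply/sd_entryP=> k i j; rewrite sd_entry_diag /sd_entry mcoeff0 mxE mul0rn.
  rewrite anti0; apply/sd_entryP=> k i j; rewrite sd_entry_diag /sd_entry mcoeff0 mxE.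
  by move: i; apply: ord2_cases; rewrite ?F0 ?F1 mul0rn.
- exists 1; rewrite eF sd_elt_unitE; apply: eq_sd_diag.
  by apply: ord2_cases; rewrite ?F0 ?F1.
- exists 0; rewrite eF sd_elt_unitE; apply: eq_sd_diag.
  by apply: ord2_cases; rewrite ?F0 ?F1.
- case/eqP: (e0_neq true); apply: sI; rewrite eF -sd_1E anti1 sd_1E; apply: eq_sd_diag.
  by apply: ord2_cases; rewrite ?F0 ?F1.
Qed.

Lemma idempotentD : e 0 + e 1 = 1.
Proof. by rewrite -sd_theta_dthetaE -sd_dtheta_thetaE sd_clifford. Qed.

Lemma anti_idempotent1 (i : 'I_2) : s (e 0) = e i -> s (e 1) = e (1 - i).
Proof.
move=> e0; have -> : e 1 = 1 - e 0 :> SDas K by rewrite -idempotentD addrAC subrr add0r.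
rewrite -scaleN1r antiD antiZ anti1 e0 scaleN1r -idempotentD.
move: i {e0}; apply: ord2_cases.
  by rewrite subr0 addrAC subrr add0r.
by rewrite subrr addrK.
Qed.

(** The reversal of products exchanges the two sides: s maps e_i A e_j into
    s(e_j) A s(e_i).  The power l of t is the one which keeps the weight. *)
Lemma anti_corner f k i j i' j' l :
  s (e i) = e i' -> s (e j) = e j' -> sd_wt l j' i' = sd_wt k i j ->
  exists g, s (sd_elt f k i j) = sd_elt g l j' i'.
Proof.
move=> ei ej lw.
have pe a : sd_parity false (e a) by have := @sd_parity_elt K 1 0 a a; rewrite eqxx.
have px : sd_parity (i != j) (sd_elt f k i j) by apply: sd_parity_elt.
have xE : sd_elt f k i j = e i * (sd_elt f k i j * e j).
  by rewrite !sd_eltM shiftp0 mulr1 rmorph1 mul1r add0r addr0.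
have px' : sd_parity (i != j) (sd_elt f k i j * e j).
  by rewrite sd_eltM; apply: sd_parity_elt.
rewrite xE (anti_mul_even_l (pe i) px') (anti_mul_even_r px (pe j)) ei ej.
eexists; apply: sd_cornerE lw; apply: s_wt; exact: sd_graded_elt.
Qed.

(** The images have polynomial coefficients g and h by anti_corner.  Applying s
    to theta d = e_0 yields - h(D + k) g(D) = 1, the sign coming from the two
    odd factors, so g and h are inverse constants up to sign. *)
Lemma anti_odd_generators (i : 'I_2) k l g h :
  s (e 0) = e i ->
  s (sd_theta K) = sd_elt g k (1 - i) i ->
  s (sd_dtheta K) = sd_elt h l i (1 - i) ->
  k + l = 0 ->
  exists2 b, b != 0 & s (sd_theta K) = b *: sd_elt 1 k (1 - i) i /\
                      s (sd_dtheta K) = - b^-1 *: sd_elt 1 l i (1 - i).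
Proof.
move=> e0 sth sdth kl.
have hg : shiftp k h * g = -1.
  have := e0; rewrite -sd_theta_dthetaE anti_mul_odd; first last.
  - by rewrite sd_dthetaE; exact: sd_parity_elt.
  - by rewrite sd_thetaE; exact: sd_parity_elt.
  rewrite sth sdth sd_eltM addrC kl => /(congr1 -%R); rewrite opprK => E.
  by move/(congr1 (fun X => sd_entry X 0 i i)): E;
     rewrite -scaleN1r -sd_elt_polyC !sd_entry_elt !eqxx polyCN.
have : g \is a GRing.unit.
  by apply/unitrP; exists (- shiftp k h); rewrite mulNr mulrN [g * _]mulrC hg opprK.
rewrite poly_unitE => /andP[/size_poly1P[b b0 gE] _].
have hE : shiftp k h = (- b^-1)%:P.
  apply: (mulIf (x := g)); first by rewrite gE polyC_eq0.
  by rewrite hg gE -polyCM mulNr mulVf // polyCN.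
exists b => //; rewrite sth sdth -!sd_elt_polyC gE; split=> //; congr sd_elt.
by rewrite -(shiftpC k) -[h]shiftp0 -(subrr k) -shiftpD hE !shiftpC.
Qed.

(** Conjugating by s(theta), which carries t^k, shifts D by k: this is the
    discrepancy between the two components of s(D). *)
Lemma anti_even_generators (i : 'I_2) k b : [pchar K] =i pred0 -> b != 0 ->
  s (sd_theta K) = b *: sd_elt 1 k (1 - i) i ->
  exists p a, [/\ p ^+ 2 = 1, s (sd_t K) = p *: sd_t K
    & s (sd_D K) = - sd_D K + a%:A + k%:~R *: e (1 - i)].
Proof.
move=> char0 b0; rewrite -sd_elt_polyC => sth.
have pth : sd_parity true (sd_theta K) by rewrite sd_thetaE; exact: sd_parity_elt.
have pt : sd_parity false (sd_t K) by rewrite sd_tE; exact: sd_parity_diag.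
have ptV : sd_parity false (sd_tinv K) by rewrite sd_tinvE; exact: sd_parity_diag.
have pD : sd_parity false (sd_D K) by rewrite sd_DdiagE; exact: sd_parity_diag.
have bP0 : b%:P != 0 by rewrite polyC_eq0.
have [P tE] : exists P, s (sd_t K) = sd_diag P 1 by rewrite sd_tE; exact: anti_diag.
have [Q tVE] : exists Q, s (sd_tinv K) = sd_diag Q (-1).
  by rewrite sd_tinvE; exact: anti_diag.
have [F DE] : exists F, s (sd_D K) = sd_diag F 0 by rewrite sd_DdiagE; exact: anti_diag.
(* s t is invertible, and a unit of K[D] is a constant. *)
have [p p0 PE0] : exists2 p, p != 0 & P i = p%:P.
  have := anti_mul_even_l ptV pt; rewrite sd_mul_tinv_t anti1 tE tVE sd_diagM subrr sd_1E.
  move=> /sd_diag_inj/(_ i) PQ.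
  have : shiftp (-1) (P i) \is a GRing.unit.
    by apply/unitrP; exists (Q i); rewrite -PQ mulrC -PQ.
  rewrite poly_unitE => /andP[/size_poly1P[p p0 pE] _]; exists p => //.
  by rewrite -[P i]shiftp0 -(addNr 1) -shiftpD pE shiftpC.
have PC : P (1 - i) = P i.
  have := anti_mul_even_r pth pt; rewrite sd_theta_t (anti_mul_even_l pt pth).
  rewrite sth tE sd_diag_eltM sd_elt_diagM addrC => /sd_elt_inj.
  rewrite shiftpC mulrC => /(mulIf bP0) PP.
  by rewrite -[LHS]shiftp0 -(subrr k) -shiftpD -PP PE0 shiftpC.
have PE j : P j = p%:P.
  have [->//|ji] := eqVneq j i; rewrite -PE0 -PC; congr P.
  by move: i j ji {sth PE0 PC}; apply: ord2_cases; apply: ord2_cases => // _; apply/val_inj.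
have tp : s (sd_t K) = p *: sd_t K.
  by rewrite tE sd_tE sd_diagZ; apply: eq_sd_diag => j; rewrite PE mulr1.
(* s (D t) = s (t D + t) reads P F = (F(D + 1) + 1) P in each component. *)
have FE j : exists a, F j = a%:P - 'X.
  apply: shiftp_decrement => //.
  have Dt : sd_D K * sd_t K = sd_t K * sd_D K + sd_t K.
    have := sd_relD ('X : {poly K}); rewrite !horner_algX => ->.
    by rewrite mulrDr mulr1.
  have := anti_mul_even_l pD pt; rewrite Dt antiD (anti_mul_even_l pt pD) tE DE.
  rewrite !sd_diagM sd_diagD !addr0 => /sd_diag_inj/(_ j).
  rewrite shiftp0 PE => E.
  apply: (mulIf (x := p%:P)); first by rewrite polyC_eq0.
  by rewrite mulrDl mul1r E mulrC.
have [a ai] := FE i; exists p, a.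
split=> //.
  have := antiK (sd_t K); rewrite tp antiZ tp scalerA -expr2 sd_tE sd_diagZ.
  by move=> /sd_diag_inj/(_ 0); rewrite mulr1 -[in RHS]polyC1 => /polyC_inj.
(* theta D = D theta compares the components of s D on both sides of theta. *)
have FC : shiftp k (F (1 - i)) = F i.
  have := anti_mul_even_r pth pD; rewrite sd_theta_D (anti_mul_even_l pD pth).
  rewrite sth DE sd_diag_eltM sd_elt_diagM addrC => /sd_elt_inj.
  by rewrite shiftp0 mulrC => /(mulIf bP0) ->.
have [a' ai'] := FE (1 - i).
have aa' : a' = a + k%:~R.
  move: FC; rewrite ai ai' raddfB /= shiftpC /shiftp comp_polyX => E.
  apply: polyC_inj; rewrite polyCD.
  by rewrite -[LHS](subrK ('X + (k%:~R)%:P)) E addrA subrK.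
rewrite DE sd_DdiagE -scaleN1r sd_elt_unitE sd_1E !sd_diagZ !sd_diagD.
apply: eq_sd_diag => j; rewrite mulr1 polyCN polyC1 mulN1r.
have [ji|ji] := eqVneq j (1 - i); rewrite ?mulr1 ?mulr0 ?addr0.
  by rewrite ji ai' aa' polyCD; ring.
have -> : j = i; last by rewrite ai addrC.
  move: i j ji {sth PE0 PC ai ai' FC}.
  by apply: ord2_cases; apply: ord2_cases => // /eqP[]; apply/val_inj.
Qed.

(** Here theta is sent to weight 1/2 in the corner of d, so that t must appear;
    s (s theta) = theta then determines the sign of s t. *)
Lemma anti_wt0_fixed : [pchar K] =i pred0 -> s (e 0) = e 0 -> exists a b : K,
  [/\ b != 0, s (sd_t K) = - sd_t K,
      s (sd_D K) = - sd_D K + a%:A + sd_dtheta K * sd_theta K,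
      s (sd_theta K) = b *: (sd_t K * sd_dtheta K)
    & s (sd_dtheta K) = - (b^-1 *: (sd_tinv K * sd_theta K))].
Proof.
move=> char0 e0; have e1 := anti_idempotent1 e0; rewrite subr0 in e1.
have [g thE] : exists g, s (sd_theta K) = sd_elt g 1 1 0.
  by rewrite sd_thetaE; apply: anti_corner.
have [h dthE] : exists h, s (sd_dtheta K) = sd_elt h (-1) 0 1.
  by rewrite sd_dthetaE; apply: anti_corner.
have [] := anti_odd_generators e0 _ _ (subrr 1) (g := g) (h := h); rewrite ?subr0 //.
move=> b b0 [{}thE {}dthE]; have thE' := thE; rewrite -{1}[1 : 'I_2]subr0 in thE'.
have [p [a [_ tE DE]]] := anti_even_generators char0 b0 thE'.
have tdE : sd_t K * sd_dtheta K = sd_elt 1 1 1 0.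
  by rewrite sd_tE sd_dthetaE sd_diag_eltM rmorph1 mulr1 addr0.
have tthE : sd_tinv K * sd_theta K = sd_elt 1 (-1) 0 1.
  by rewrite sd_tinvE sd_thetaE sd_diag_eltM rmorph1 mulr1 addr0.
have pN1 : p = -1.
  have := antiK (sd_theta K); rewrite thE antiZ -tdE (@anti_mul_even_l true).
  - rewrite tE dthE -!scalerAl -!scalerAr !scalerA sd_tE sd_elt_diagM rmorph1 mulr1 addNr.
    rewrite sd_thetaE -[X in _ = X]scale1r -!sd_elt_polyC => /sd_elt_inj/polyC_inj.
    by rewrite mulrN mulfV // mulN1r => <-; rewrite opprK.
  - by rewrite sd_tE; exact: sd_parity_diag.
  - by rewrite sd_dthetaE; exact: sd_parity_elt.
exists a, b; split.
- exact: b0.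
- by rewrite tE pN1 scaleN1r.
- by rewrite DE scale1r subr0 sd_dtheta_thetaE.
- rewrite tdE; exact: thE.
- by rewrite tthE dthE scaleNr.
Qed.

(** Here theta is sent to a multiple of itself, and D is shifted equally in both
    components: only the involutivity constrains the two constants. *)
Lemma anti_wt0_swapped : [pchar K] =i pred0 -> s (e 0) = e 1 -> exists p b a : K,
  [/\ p ^+ 2 = 1, b ^+ 2 = 1 & [/\ s (sd_t K) = p *: sd_t K,
      s (sd_D K) = - sd_D K + a%:A, s (sd_theta K) = b *: sd_theta K
    & s (sd_dtheta K) = - b *: sd_dtheta K]].
Proof.
move=> char0 e0; have e1 := anti_idempotent1 e0; rewrite subrr in e1.
have [g thE] : exists g, s (sd_theta K) = sd_elt g 0 0 1.
  by rewrite {1}sd_thetaE; apply: anti_corner.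
have [h dthE] : exists h, s (sd_dtheta K) = sd_elt h 0 1 0.
  by rewrite {1}sd_dthetaE; apply: anti_corner.
have [] := anti_odd_generators e0 _ _ (addr0 0) (g := g) (h := h); rewrite ?subrr //.
move=> b b0 [{}thE {}dthE]; have thE' := thE; rewrite -{1}(subrr (1 : 'I_2)) in thE'.
have [p [a [p2 tE DE]]] := anti_even_generators char0 b0 thE'.
have b2 : b ^+ 2 = 1.
  have := antiK (sd_theta K); rewrite thE antiZ -sd_thetaE thE scalerA -expr2 sd_thetaE.
  by rewrite -[X in _ = X]scale1r -!sd_elt_polyC => /sd_elt_inj/polyC_inj.
exists p, b, a; split; [exact: p2 | exact: b2 | split].
- exact: tE.
- rewrite DE mulr0z scale0r addr0; reflexivity.
- rewrite thE sd_thetaE; reflexivity.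
- rewrite dthE sd_dthetaE; congr (- _ *: _).
  by apply: (mulfI b0); rewrite mulfV // -expr2.
Qed.

End AntiInvolutions.

Theorem theorem3p1 (R : realType) (s : SDas R[i] -> SDas R[i]) :
  anti_involution s -> preserves_principal_gradation s ->
  let t := sd_t R[i] in
  let tinv := sd_tinv R[i] in
  let D := sd_D R[i] in
  let theta := sd_theta R[i] in
  let dtheta := sd_dtheta R[i] in
  (exists a b : R[i],
     [/\ b != 0, s t = - t, s D = - D + a%:A + dtheta * theta,
         s theta = b *: (t * dtheta)
       & s dtheta = - (b^-1 *: (tinv * theta))]) \/
  (exists a : R[i],
     [/\ s t = t, s D = - D + a%:A, s theta = theta & s dtheta = - dtheta]) \/
  (exists a : R[i],
     [/\ s t = t, s D = - D + a%:A, s theta = - theta & s dtheta = dtheta]) \/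
  (exists a : R[i],
     [/\ s t = - t, s D = - D + a%:A, s theta = theta & s dtheta = - dtheta]) \/
  (exists a : R[i],
     [/\ s t = - t, s D = - D + a%:A, s theta = - theta & s dtheta = dtheta]).
Proof.
move=> s_anti s_wt t tinv D theta dtheta.
have char0 := Num.Theory.pchar_num R[i].
have sqr1 (x : R[i]) : x ^+ 2 = 1 -> x = 1 \/ x = -1.
  by move=> /eqP; rewrite sqrf_eq1 => /orP[] /eqP; [left | right].
have [j sej] := anti_idempotent0 s_anti s_wt; move: j sej; apply: ord2_cases => e0.
  by left; apply: anti_wt0_fixed.
have [p [b [a [p2 b2 []]]]] := anti_wt0_swapped s_anti s_wt char0 e0.
rewrite -/t -/D -/theta -/dtheta => tE DE thE dthE; right.
case: (sqr1 p p2) (sqr1 b b2) => pE [] bE;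
  rewrite {}pE {}bE ?opprK ?scaleN1r ?scale1r in tE thE dthE.
- by left; exists a.
- by right; left; exists a.
- by right; right; left; exists a.
- by right; right; right; exists a.
Qed.
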